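(* Let $n > 3$ be an integer, let $p_i$ denote the $i$th prime number, and let $\pi(x)$ denote the prime counting function. Then $n$ is prime if and only if $$\sum_{i=1}^{\pi(\sqrt{n})} \left( \binom{n-1}{p_i-1} \bmod p_i \right) = 0.$$
   Context: The primes are listed in increasing order, $p_1 = 2, p_2 = 3, p_3 = 5, \dots$; $\pi(x)$ is the number of primes less than or equal to the real number $x$. For an integer $a$ and a positive integer $m$, $a \bmod m$ denotes the remainder in $\{0,1,\dots,m-1\}$ of $a$ upon division by $m$. The sum is a sum of remainders, taken as an ordinary sum of nonnegative integers. *)

(* Defs.v *)
From mathcomp Require Import all_boot all_order all_algebra.
From mathcomp Require Import reals.
Set Implicit Arguments.
Unset Strict Implicit.
Unset Printing Implicit Defensive.
Import Order.TTheory GRing.Theory Num.Theory.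

Lemma exists_prime_gt (m : nat) : exists p, prime p && (m < p).
Proof. by have [p lt_mp pr_p] := prime_above m; exists p; rewrite pr_p. Qed.

Definition next_prime (m : nat) : nat := ex_minn (exists_prime_gt m).

(* Indexed from 1: nth_prime 1 = 2, nth_prime 2 = 3, nth_prime 3 = 5, and so
   on.  The value nth_prime 0 = 0 is only the seed of the iteration. *)
Definition nth_prime (i : nat) : nat := iter i next_prime 0.

(* Since `|x| < (Num.bound x)%:R, the range of p contains every natural number
   p with p%:R <= x. *)
Definition prime_pi (R : realType) (x : R) : nat :=
  #|[set p : 'I_(Num.bound x) | prime p & (p%:R <= x)%R]|.

(* Main.v *)
Require Import Defs.
From mathcomp Require Import all_boot all_order all_algebra.
From mathcomp Require Import reals.

Import Order.TTheory GRing.Theory Num.Theory.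

(** The remainder of 'C(n - 1, p - 1) modulo a prime p detects whether p
    divides n: the binomial is divisible by p exactly when n is not
    ([dvdn_bin_pred]).  A sum of naturals vanishes only when all its terms do,
    so the sum is zero exactly when no prime p <= sqrt n divides n, and that is
    trial division: a composite n has a prime divisor whose square is at most
    n, while a prime n has only itself, and n < n ^ 2.

    The remaining point is that the indices 1, ..., pi(sqrt n) enumerate
    exactly the primes p <= sqrt n.  It follows from the fact that the number
    of primes up to m, as a function of m, is inverse on the primes to
    [nth_prime] ([nth_prime_count]). *)

(** By absorption, p * 'C(n, p) = n * 'C(n - 1, p - 1), so p divides the
    binomial if it does not divide n.  If p divides n, then p divides 'C(n, j)
    for 0 < j < p, so Pascal's rule makes the 'C(n - 1, j) with j < p alternate
    between 1 and -1 modulo p, and none of them is 0 modulo p. *)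
Lemma dvdn_bin_pred (p n : nat) : prime p -> 0 < n ->
  (p %| 'C(n - 1, p - 1)) = ~~ (p %| n).
Proof.
move=> pr_p; case: n => // n _; rewrite subn1 /=.
have p_gt0 := prime_gt0 pr_p.
have [p_dv|p_ndv] /= := boolP (p %| n.+1); last first.
  have absorb := mul_bin_diag n.+1 p.-1; rewrite prednK //= in absorb.
  rewrite subn1.
  have : p %| n.+1 * 'C(n, p.-1) by rewrite absorb dvdn_mulr.
  by rewrite Gauss_dvdr // prime_coprime.
apply/negbTE.
have: p - 1 < p by rewrite subn1 prednK.
elim: (p - 1) => [|j IHj] ltjp.
  by rewrite bin0 dvdn1 neq_ltn prime_gt1 ?orbT.
have p_bin : p %| 'C(n.+1, j.+1).
  have: p %| j.+1 * 'C(n.+1, j.+1) by rewrite -mul_bin_diag /= dvdn_mulr.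
  by rewrite Gauss_dvdr // prime_coprime // gtnNdvd.
apply: contra (IHj (ltnW ltjp)) => p_bin'.
by rewrite -(dvdn_addr _ p_bin') -binS.
Qed.

Definition prime_count (m : nat) : nat := \sum_(0 <= q < m.+1) prime q.

Lemma prime_countS (m : nat) : prime_count m.+1 = prime_count m + prime m.+1.
Proof. by rewrite /prime_count big_nat_recr. Qed.

Lemma leq_prime_count (m k : nat) : m <= k -> prime_count m <= prime_count k.
Proof.
move=> /subnK <-; elim: (k - m) => // d IHd.
by rewrite addSn prime_countS (leq_trans IHd) ?leq_addr.
Qed.

Lemma prime_count_prime (p : nat) : prime p ->
  prime_count p = (prime_count p.-1).+1.
Proof. by case: p => // p pr_p; rewrite prime_countS pr_p addn1. Qed.

Lemma ltn_prime_count (m p : nat) : prime p -> m < p ->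
  prime_count m < prime_count p.
Proof.
move=> pr_p ltmp; rewrite (prime_count_prime _ pr_p) ltnS leq_prime_count //.
by case: p ltmp {pr_p}.
Qed.

Lemma prime_count_inj (p q : nat) : prime p -> prime q ->
  prime_count p = prime_count q -> p = q.
Proof.
move=> pr_p pr_q eq_pq; case: (ltngtP p q) => //.
  by move/(ltn_prime_count _ _ pr_q); rewrite eq_pq ltnn.
by move/(ltn_prime_count _ _ pr_p); rewrite eq_pq ltnn.
Qed.

Lemma prime_nth_prime (i : nat) : prime (nth_prime i.+1).
Proof.
by rewrite /nth_prime /= /next_prime; case: ex_minnP => q /andP[].
Qed.

Lemma prime_count_next_prime (m : nat) :
  prime_count (next_prime m) = (prime_count m).+1.
Proof.
rewrite /next_prime; case: ex_minnP => q /andP[pr_q ltmq] q_min.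
have Dq : q = (m + (q.-1 - m)).+1.
  by case: q ltmq {pr_q q_min} => // q; rewrite ltnS => ?; rewrite subnKC.
rewrite prime_count_prime // [in q.-1]Dq /=; congr _.+1.
have: m + (q.-1 - m) < q by rewrite -Dq.
(* No prime lies in ]m, q[, so the count stays constant up to q - 1. *)
elim: (q.-1 - m) => [|d IHd]; first by rewrite addn0.
rewrite addnS prime_countS => ltdq; rewrite IHd ?(ltnW ltdq) //.
suff /negbTE-> : ~~ prime (m + d).+1 by rewrite addn0.
apply: contraL ltdq => pr_d; rewrite -leqNgt q_min // pr_d /=.
by rewrite ltnS leq_addr.
Qed.

Lemma prime_count_nth_prime (i : nat) : prime_count (nth_prime i) = i.
Proof.
elim: i => [|i IHi]; first by rewrite /prime_count big_nat1.
by rewrite /nth_prime /= prime_count_next_prime IHi.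
Qed.

(** [prime_count] is a left inverse of [nth_prime] and is injective on the
    primes, hence also a right inverse there. *)
Lemma nth_prime_count (p : nat) : prime p -> nth_prime (prime_count p) = p.
Proof.
move=> pr_p; apply: prime_count_inj; rewrite ?prime_count_nth_prime //.
by rewrite prime_count_prime // prime_nth_prime.
Qed.

Lemma sum_nth_prime (F : nat -> nat) (m : nat) :
  \sum_(1 <= i < (prime_count m).+1) F (nth_prime i)
    = \sum_(0 <= p < m.+1 | prime p) F p.
Proof.
elim: m => [|m IHm].
  by rewrite /prime_count big_nat1 big_geq // big_mkcond big_nat1.
rewrite [RHS]big_mkcond big_nat_recr //= -big_mkcond -IHm prime_countS.
have [pr_m|_] := boolP (prime m.+1); last by rewrite !addn0.
rewrite addn1 big_nat_recr //=; congr (_ + F _).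
by rewrite -[in RHS](nth_prime_count _ pr_m) prime_countS pr_m addn1.
Qed.

Lemma prime_pi_truncn (R : realType) (x : R) : (0 <= x)%R ->
  prime_pi x = prime_count (Num.truncn x).
Proof.
move=> x_ge0; set m := Num.truncn x.
have le_m (q : nat) : (q%:R <= x)%R = (q <= m) by rewrite truncn_ge_nat.
have ltmN : m < Num.bound x.
  rewrite -(ltr_nat R); apply: le_lt_trans (archi_boundP x_ge0).
  by rewrite le_m.
rewrite /prime_count big_mkord.
rewrite (big_ord_widen _ (fun q => nat_of_bool (prime q)) ltmN).
rewrite /prime_pi cardsE -sum1_card big_mkcond [RHS]big_mkcond /=.
apply: eq_bigr => q _; rewrite unfold_in /= le_m ltnS.
by case: (prime q); case: (q <= m).
Qed.

Lemma leq_truncn_sqrt (R : realType) (p n : nat) :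
  (p <= Num.truncn (Num.sqrt (n%:R : R)%R)) = (p ^ 2 <= n).
Proof.
rewrite truncn_ge_nat ?sqrtr_ge0 // -(ler_nat R) natrX.
rewrite -[in RHS](@sqr_sqrtr R n%:R) ?ler0n //.
by rewrite ler_pXn2r // nnegrE ?ler0n ?sqrtr_ge0.
Qed.

Theorem theorem2p1 (R : realType) (n : nat) (hn : 3 < n) :
  prime n <->
  \sum_(1 <= i < (prime_pi (Num.sqrt (n%:R : R)%R)).+1)
     ('C(n - 1, nth_prime i - 1) %% nth_prime i) = 0.
Proof.
have n_gt0 : 0 < n by apply: leq_trans hn.
rewrite prime_pi_truncn ?sqrtr_ge0 //.
rewrite (sum_nth_prime (fun p => 'C(n - 1, p - 1) %% p)).
split=> [pr_n | /eqP].
  rewrite big_nat_cond big1 // => p.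
  rewrite ltnS leq_truncn_sqrt => /andP[p2_le_n pr_p]; apply/eqP.
  rewrite -[_ == 0]/(p %| _) dvdn_bin_pred // dvdn_prime2 //.
  apply: contraL p2_le_n => /eqP->; rewrite -ltnNge.
  by rewrite -[n in n < _]expn1 ltn_exp2l // prime_gt1.
rewrite sum_nat_seq_eq0 => /allP no_div.
apply: ltn_pdiv2_prime => //; rewrite ltnNge; apply/negP => q2_le_n.
have pr_q : prime (pdiv n) by rewrite pdiv_prime // (leq_trans _ hn).
have := no_div (pdiv n); rewrite mem_index_iota ltnS leq_truncn_sqrt.
move=> /(_ q2_le_n); rewrite pr_q -[_ == 0]/(pdiv n %| _).
by rewrite dvdn_bin_pred // pdiv_dvd.
Qed.
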